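(* Let $C,D$ be finite sets and $M\colon C\times D\to\mathbb R$ a real matrix. Let $(f,g)\in\mathbb P\mathrm{Nuc}(M)$ and let $(c,d)\in C\times D$. Then $$d_{\mathbb P\mathrm{Nuc}}\bigl((f,g),\mathcal E_{c,d}\bigr)=\delta^{(f,g)}(c,d).$$
   Context: $C,D$ are nonempty finite sets and $M\colon C\times D\to\mathbb R$. For $f\colon C\to\mathbb R$ and $g\colon D\to\mathbb R$ put $(M^*f)(d)=\min_{c\in C}(M(c,d)-f(c))$ and $(M_*g)(c)=\min_{d\in D}(M(c,d)-g(d))$. A nucleus pair is $(f,g)\in\mathbb R^C\times\mathbb R^D$ with $g=M^*f$ and $f=M_*g$ (since $M$ is real-valued, extended-real solutions that are finite somewhere are automatically real-valued, so only real-valued pairs are needed). The projective nucleus $\mathbb P\mathrm{Nuc}(M)$ is the set of nucleus pairs modulo $(f,g)\sim(f+\lambda,g-\lambda)$, $\lambda\in\mathbb R$; classes are written by representatives $(f,g)$. Its metric is $$d_{\mathbb P\mathrm{Nuc}}((f,g),(f',g'))=\max\{d_C([f],[f']),d_D([g],[g'])\},$$ where $d_C([f],[f'])=\max_{c}(f(c)-f'(c))-\min_{c}(f(c)-f'(c))$ and $d_D$ is defined in the same way on functions on $D$. For a subset $S\subseteq\mathbb P\mathrm{Nuc}(M)$, $d_{\mathbb P\mathrm{Nuc}}((f,g),S)=\inf_{(f',g')\in S}d_{\mathbb P\mathrm{Nuc}}((f,g),(f',g'))$. The gap matrix at $(f,g)$ is $\delta^{(f,g)}(c,d)=M(c,d)-f(c)-g(d)$;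 it is nonnegative and depends only on the class of $(f,g)$. The event locus of $(c,d)$ is $\mathcal E_{c,d}=\{(f',g')\in\mathbb P\mathrm{Nuc}(M)\mid\delta^{(f',g')}(c,d)=0\}$. *)

(* Defs.v *)
From HB Require Import structures.
From mathcomp Require Import all_boot all_order all_algebra.
From mathcomp Require Import boolp classical_sets reals ereal constructive_ereal.

Set Implicit Arguments.
Unset Strict Implicit.
Unset Printing Implicit Defensive.

Import Order.TTheory GRing.Theory Num.Theory.
Local Open Scope classical_set_scope.
Local Open Scope quotient_scope.
Local Open Scope ring_scope.

Section FiniteExtrema.
Variables (R : realType) (T : finType).
Implicit Type F : T -> R.

(* The value 0 is a placeholder, reached only when T is empty. *)
Definition fmin F : R :=
  if [pick x : T] is Some x0 then \big[Num.min/F x0]_(x : T) F x else 0.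

Definition fmax F : R :=
  if [pick x : T] is Some x0 then \big[Num.max/F x0]_(x : T) F x else 0.

Lemma fmin_le F x : fmin F <= F x.
Proof.
rewrite /fmin; case: pickP => [x0 _|/(_ x)//].
exact: bigmin_le_cond.
Qed.

Lemma fmin_attained F (x1 : T) : exists x, fmin F = F x.
Proof.
rewrite /fmin; case: pickP => [x0 _|/(_ x1)//].
elim/big_ind: _ => [|_ _ [x ->] [y ->]|x _]; first by exists x0.
  by rewrite minEle; case: ifP => _; [exists x | exists y].
by exists x.
Qed.

Lemma fmax_ge F x : F x <= fmax F.
Proof.
rewrite /fmax; case: pickP => [x0 _|/(_ x)//].
exact: le_bigmax_cond.
Qed.

Lemma fmax_attained F (x1 : T) : exists x, fmax F = F x.
Proof.
rewrite /fmax; case: pickP => [x0 _|/(_ x1)//].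
elim/big_ind: _ => [|_ _ [x ->] [y ->]|x _]; first by exists x0.
  by rewrite maxEle; case: ifP => _; [exists y | exists x].
by exists x.
Qed.

Lemma fmin_addr (x1 : T) F (l : R) : fmin (fun x => F x + l) = fmin F + l.
Proof.
have [x Ex] := fmin_attained (fun x => F x + l) x1.
have [y Ey] := fmin_attained F x1.
apply/le_anti/andP; split; first by rewrite Ey; apply: fmin_le.
by rewrite Ex lerD2r; apply: fmin_le.
Qed.

Lemma fmax_addr (x1 : T) F (l : R) : fmax (fun x => F x + l) = fmax F + l.
Proof.
have [x Ex] := fmax_attained (fun x => F x + l) x1.
have [y Ey] := fmax_attained F x1.
apply/le_anti/andP; split; first by rewrite Ex lerD2r; apply: fmax_ge.
by rewrite Ey; apply: fmax_ge.
Qed.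

Definition osc_dist (f f' : {ffun T -> R}) : R :=
  fmax (fun x => f x - f' x) - fmin (fun x => f x - f' x).

Lemma osc_dist_shift (f f' : {ffun T -> R}) (l l' : R) :
  osc_dist [ffun x => f x + l] [ffun x => f' x + l'] = osc_dist f f'.
Proof.
rewrite /osc_dist.
have -> : (fun x => [ffun x => f x + l] x - [ffun x => f' x + l'] x) =
          (fun x => f x - f' x + (l - l')).
  by apply/funext => x; rewrite !ffunE opprD addrACA.
case: (pickP (@predT T)) => [x1 _|T0].
  by rewrite (fmin_addr x1) (fmax_addr x1) opprD addrACA subrr addr0.
by rewrite /fmax /fmin; case: pickP => // x; have := T0 x.
Qed.

End FiniteExtrema.

Section Nucleus.
Variables (R : realType) (C D : finType) (M : C -> D -> R).

Definition upper_conj (f : {ffun C -> R}) : {ffun D -> R} :=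
  [ffun d => fmin (fun c => M c d - f c)].

Definition lower_conj (g : {ffun D -> R}) : {ffun C -> R} :=
  [ffun c => fmin (fun d => M c d - g d)].

Definition is_nucleus (p : {ffun C -> R} * {ffun D -> R}) : bool :=
  (p.2 == upper_conj p.1) && (p.1 == lower_conj p.2).

Record nucleus := Nucleus {
  nucleus_pair :> {ffun C -> R} * {ffun D -> R};
  _ : is_nucleus nucleus_pair }.

HB.instance Definition _ := [isSub for nucleus_pair].
HB.instance Definition _ := [Choice of nucleus by <:].

Definition shift_equiv (x y : nucleus) : bool :=
  `[< exists l : R, y.1 = [ffun c => x.1 c + l] /\
                    y.2 = [ffun d => x.2 d - l] >].

Lemma shift_equiv_refl : reflexive shift_equiv.
Proof.
move=> x; apply/asboolP; exists 0.
by split; apply/ffunP => i; rewrite ffunE ?subr0 ?addr0.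
Qed.

Lemma shift_equiv_subsym x y : shift_equiv x y -> shift_equiv y x.
Proof.
move=> /asboolP[l [E1 E2]]; apply/asboolP; exists (- l).
by split; apply/ffunP => i; rewrite ffunE ?E1 ?E2 ffunE ?addrK.
Qed.

Lemma shift_equiv_sym : symmetric shift_equiv.
Proof. by move=> x y; apply/idP/idP; apply: shift_equiv_subsym. Qed.

Lemma shift_equiv_trans : transitive shift_equiv.
Proof.
move=> y x z /asboolP[l [E1 E2]] /asboolP[l' [E1' E2']].
apply/asboolP; exists (l + l').
by split; apply/ffunP => i; rewrite ?E1' ?E2' !ffunE ?E1 ?E2 !ffunE ?addrA ?opprD ?addrA.
Qed.

Canonical shift_equiv_rel :=
  EquivRel shift_equiv shift_equiv_refl shift_equiv_sym shift_equiv_trans.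

Definition pnuc := {eq_quot shift_equiv_rel}.

Definition nuc_gap (x : nucleus) (c : C) (d : D) : R :=
  M c d - x.1 c - x.2 d.

Definition nuc_dist (x y : nucleus) : R :=
  Num.max (osc_dist x.1 y.1) (osc_dist x.2 y.2).

(* gap and pnuc_dist read off the canonical representative of a class; gap_pi
   and pnuc_dist_pi show that any representative gives the same value. *)
Definition gap (p : pnuc) (c : C) (d : D) : R := nuc_gap (repr p) c d.

Definition pnuc_dist (p q : pnuc) : R := nuc_dist (repr p) (repr q).

Lemma shift_equiv_repr (x : nucleus) : shift_equiv x (repr (\pi_pnuc x)).
Proof. by apply/eqmodP; rewrite reprK. Qed.

Lemma gap_pi (x : nucleus) c d : gap (\pi_pnuc x) c d = nuc_gap x c d.
Proof.
rewrite /gap /nuc_gap; have /asboolP[l [-> ->]] := shift_equiv_repr x.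
by rewrite !ffunE !opprD opprK !addrA addrAC subrK.
Qed.

Lemma pnuc_dist_pi (x y : nucleus) :
  pnuc_dist (\pi_pnuc x) (\pi_pnuc y) = nuc_dist x y.
Proof.
rewrite /pnuc_dist /nuc_dist.
have /asboolP[l [-> ->]] := shift_equiv_repr x.
have /asboolP[l' [-> ->]] := shift_equiv_repr y.
by rewrite !osc_dist_shift.
Qed.

(* Extended-real infimum, so that the distance to the empty set is +oo. *)
Definition pnuc_dist_set (p : pnuc) (S : set pnuc) : \bar R :=
  ereal_inf [set (pnuc_dist p q)%:E | q in S].

Definition event_locus (c : C) (d : D) : set pnuc :=
  [set q | gap q c d = 0].

End Nucleus.

Arguments event_locus {R C D} M c d.

(* Main.v *)
Require Import Defs.
From mathcomp Require Import all_boot all_order all_algebra.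
From mathcomp Require Import boolp classical_sets reals ereal constructive_ereal.
From mathcomp Require Import lra.

(** Write [delta] for the gap of [(f, g)] at [(c, d)]. The distance from
    [(f, g)] to the event locus is [delta] because every point of the locus is
    at least that far away and one point is no further.

    Lower bound ([nuc_gap_le_dist]): the minimum defining [f c] is attained, so
    some column [d0] has gap zero at [(f, g)]. Going to a point [(f', g')]
    of the locus, [f c + g d] grows by [delta] whereas [f c + g d0], which is
    already [M c d0], cannot grow. Hence [g' - g] is larger at [d] than at [d0]
    by at least [delta], and the distance between [g] and [g'] alone is at
    least [delta].

    Upper bound ([event_point_exists]): raise the single value [g d] by
    [delta], which is just enough to close the gap at [(c, d)], and project back
    to the nucleus by taking [f' = M_* g1] and [g' = M^* f'], where [g1] is the
    raised function. It is a nucleus pair because [M_*] and [M^*] form an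
    antitone Galois connection. As conjugation reverses order and turns
    [h + delta] into [h^* - delta], the bounds [g <= g1 <= g + delta] give
    [f - delta <= f' <= f] and then [g <= g' <= g + delta], so both components
    move by at most [delta] in oscillation. The gap at [(c, d)] does vanish:
    [f' c = f c], since the raise stops exactly when the constraint at [(c, d)]
    becomes tight. *)

Set Implicit Arguments.
Unset Strict Implicit.
Unset Printing Implicit Defensive.

Import Order.TTheory GRing.Theory Num.Theory.
Local Open Scope classical_set_scope.
Local Open Scope quotient_scope.
Local Open Scope ring_scope.

Section Oscillation.
Variables (R : realType) (T : finType).

Lemma le_fmin (x1 : T) (F : T -> R) a : (forall x, a <= F x) -> a <= fmin F.
Proof. by move=> aF; have [x ->] := fmin_attained F x1. Qed.

Lemma osc_dist_ge (f f' : {ffun T -> R}) x y :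
  (f x - f' x) - (f y - f' y) <= osc_dist f f'.
Proof.
by apply: lerB; [apply: (fmax_ge (fun z => f z - f' z))
                |apply: (fmin_le (fun z => f z - f' z))].
Qed.

Lemma osc_dist_le (x1 : T) (f f' : {ffun T -> R}) a e :
  (forall x, a <= f x - f' x <= a + e) -> osc_dist f f' <= e.
Proof.
move=> ae; rewrite /osc_dist.
have [x ->] := fmax_attained (fun z => f z - f' z) x1.
have [y ->] := fmin_attained (fun z => f z - f' z) x1.
by have := ae x; have := ae y; lra.
Qed.

End Oscillation.

Section EventDistance.
Variables (R : realType) (C D : finType) (M : C -> D -> R).
Implicit Types (f : {ffun C -> R}) (g : {ffun D -> R}).

Lemma upper_conj_le f c d : upper_conj M f d <= M c d - f c.
Proof. by rewrite ffunE; apply: (fmin_le (fun c => M c d - f c)). Qed.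

Lemma lower_conj_le g c d : lower_conj M g c <= M c d - g d.
Proof. by rewrite ffunE; apply: (fmin_le (fun d => M c d - g d)). Qed.

Lemma le_upper_conj (c0 : C) f d a :
  (forall c, a <= M c d - f c) -> a <= upper_conj M f d.
Proof. by move=> h; rewrite ffunE; apply: le_fmin. Qed.

Lemma le_lower_conj (d0 : D) g c a :
  (forall d, a <= M c d - g d) -> a <= lower_conj M g c.
Proof. by move=> h; rewrite ffunE; apply: le_fmin. Qed.

Lemma le_upper_lower_conj (c0 : C) g d :
  g d <= upper_conj M (lower_conj M g) d.
Proof.
by apply: le_upper_conj => // c; have := lower_conj_le g c d; lra.
Qed.

(** The triple-conjugate identity [M_* M^* M_* = M_*] of a Galois connection. *)
Lemma is_nucleus_conj (c0 : C) (d0 : D) g :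
  is_nucleus M (lower_conj M g, upper_conj M (lower_conj M g)).
Proof.
rewrite /is_nucleus /= eqxx; apply/eqP/ffunP => c.
apply/le_anti/andP; split.
  apply: le_lower_conj => // d.
  by have := upper_conj_le (lower_conj M g) c d; lra.
apply: le_lower_conj => // d.
by have := lower_conj_le (upper_conj M (lower_conj M g)) c d;
   have := le_upper_lower_conj c0 g d; lra.
Qed.

Lemma nucleus_upperE (x : nucleus M) : x.2 = upper_conj M x.1.
Proof. by case: x => p /= /andP[/eqP]. Qed.

Lemma nucleus_lowerE (x : nucleus M) : x.1 = lower_conj M x.2.
Proof. by case: x => p /= /andP[_ /eqP]. Qed.

Lemma nuc_gap_ge0 (x : nucleus M) c d : 0 <= nuc_gap x c d.
Proof.
by have := upper_conj_le x.1 c d; rewrite -nucleus_upperE /nuc_gap; lra.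
Qed.

Lemma nuc_gap_tight (x : nucleus M) c (d1 : D) : exists d, nuc_gap x c d = 0.
Proof.
have [d Ed] := fmin_attained (fun d => M c d - x.2 d) d1.
by exists d; rewrite /nuc_gap [x.1]nucleus_lowerE ffunE Ed; lra.
Qed.

(** The second components alone are already this far apart. Take [d0] tight for
    [x] in row [c]: there [y] cannot raise the sum of the two values, while at
    [d] it raises that sum by the whole gap; the common value at [c] cancels. *)
Lemma nuc_gap_le_dist (x y : nucleus M) c d :
  nuc_gap y c d = 0 -> nuc_gap x c d <= nuc_dist x y.
Proof.
move=> yE; have [d0] := nuc_gap_tight x c d.
rewrite /nuc_dist le_max => xE; apply/orP; right.
apply: le_trans (osc_dist_ge x.2 y.2 d0 d).
by have := nuc_gap_ge0 y c d0; move: xE yE; rewrite /nuc_gap; lra.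
Qed.

(** The point is the conjugate of the cheapest modification of [x.2] that makes
    [(c, d)] tight: a raise at [d] alone. Order reversal confines the effect of
    the two conjugations to the size of that raise. *)
Lemma event_point_exists (x : nucleus M) c d :
  exists2 y : nucleus M,
    nuc_gap y c d = 0 & nuc_dist x y <= nuc_gap x c d.
Proof.
set e := nuc_gap x c d; have e0 : 0 <= e := nuc_gap_ge0 x c d.
pose g1 : {ffun D -> R} := [ffun d' => x.2 d' + (if d' == d then e else 0)].
have g1E d' : x.2 d' <= g1 d' <= x.2 d' + e.
  by rewrite ffunE; case: eqP => _; lra.
have g1d : g1 d = x.2 d + e by rewrite ffunE eqxx.
pose f' := lower_conj M g1; pose g' := upper_conj M f'.
have xfg c' d' : x.1 c' + x.2 d' <= M c' d'.
  by have := nuc_gap_ge0 x c' d'; rewrite /nuc_gap; lra.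
have f'le c' : f' c' <= x.1 c'.
  rewrite [x.1]nucleus_lowerE; apply: le_lower_conj => // d'.
  by have := lower_conj_le g1 c' d'; have := g1E d'; rewrite -/f'; lra.
have f'ge c' : x.1 c' - e <= f' c'.
  by apply: le_lower_conj => // d'; have := xfg c' d'; have := g1E d'; lra.
have g'ge d' : x.2 d' <= g' d'.
  apply: le_trans (le_upper_lower_conj c g1 d').
  by have /andP[] := g1E d'.
have g'le d' : g' d' <= x.2 d' + e.
  suff : g' d' - e <= x.2 d' by lra.
  rewrite [x.2]nucleus_upperE; apply: le_upper_conj => // c'.
  by have := upper_conj_le f' c' d'; have := f'ge c'; rewrite -/g'; lra.
(* The raise by [e] is exactly what the constraint at [(c, d)] leaves room for,
   so the value at [c] survives; a larger raise would lower it. *)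
have f'c : x.1 c <= f' c.
  apply: le_lower_conj => // d'; rewrite ffunE.
  case: eqP => [->|_]; last by have := xfg c d'; lra.
  by rewrite /e /nuc_gap; lra.
exists (Nucleus (is_nucleus_conj c d g1)); rewrite /nuc_gap /nuc_dist /=.
  rewrite -/f' -/g'; have := le_upper_lower_conj c g1 d.
  have := upper_conj_le f' c d; rewrite -/f' -/g' g1d.
  by move: f'c (f'le c); rewrite /e /nuc_gap; lra.
rewrite -/f' -/g' ge_max; apply/andP; split.
  apply: (osc_dist_le c (a := 0)) => c'.
  by have := f'le c'; have := f'ge c'; lra.
apply: (osc_dist_le d (a := - e)) => d'.
by have := g'le d'; have := g'ge d'; lra.
Qed.

End EventDistance.

Theorem theorem40 (R : realType) (C D : finType) (M : C -> D -> R)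
    (p : pnuc M) (c : C) (d : D) :
  pnuc_dist_set p (event_locus M c d) = ((gap p c d)%:E)%E.
Proof.
apply/le_anti/andP; split.
  have [y yE yd] := event_point_exists (repr p) c d.
  apply: (@le_trans _ _ (pnuc_dist p (\pi_(pnuc M) y))%:E).
    apply: ereal_inf_lbound; exists (\pi_(pnuc M) y) => //.
    by rewrite /event_locus /= gap_pi.
  by rewrite lee_fin -[in leLHS](reprK p) pnuc_dist_pi.
apply: le_ereal_inf_tmp => _ [q qE <-]; rewrite lee_fin.
exact: nuc_gap_le_dist.
Qed.
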